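(* Let $\mathcal{M}$ be a closed genus-zero simplicial surface, and let $\{\mathbf{f}^{(k)}\}_{k\ge 0}\subset\mathbb{R}^{2(n-2)}$ be the iterates of the preconditioned nonlinear conjugate gradient method for the spherical authalic energy $E_{\mathbb{A}}$ (described in the context), with gradients $\mathbf{g}^{(k)}=\nabla_{\mathbf{f}}E_{\mathbb{A}}(\mathbf{f}^{(k)})$, search directions $\mathbf{p}^{(k)}$, step lengths $\alpha_k$ and preconditioner $M$. Suppose that each step length $\alpha_k$ satisfies the strong Wolfe conditions $$E_{\mathbb{A}}(\mathbf{f}^{(k+1)})-E_{\mathbb{A}}(\mathbf{f}^{(k)})\leq c_1\,\alpha_k\,{\mathbf{g}^{(k)}}^\top\mathbf{p}^{(k)},\qquad \big|{\mathbf{g}^{(k+1)}}^\top\mathbf{p}^{(k)}\big|\leq c_2\,\big|{\mathbf{g}^{(k)}}^\top\mathbf{p}^{(k)}\big|,$$ with $0<c_1<c_2<\frac12$. Assume that the iterates $\{\mathbf{f}^{(k)}\}$ remain in a compact subset of the nondegenerate region, and that $M$ is a symmetric positive definite matrix. Then $$\liminf_{k\to\infty}\|\mathbf{g}^{(k)}\|_{M^{-1}}=0.$$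
   Context: Surface and maps. $\mathcal{M}\subset\mathbb{R}^3$ is the union of the flat triangles of a triangular mesh with vertices $v_1,\dots,v_n$, oriented faces $\mathcal{F}(\mathcal{M})$ (written $\tau=[v_i,v_j,v_k]$) and edges $\mathcal{E}(\mathcal{M})$; $|\tau|$ is the area of a triangle and $|\mathcal{M}|=\sum_\tau|\tau|$. A spherical simplicial map $f$ is affine on each face and is given by its vertex images $f_i=f(v_i)\in\mathbb{S}^2$, $i=1,\dots,n$; the image of $[v_i,v_j,v_k]$ is the flat triangle $[f_i,f_j,f_k]$. Energy. $E_{\mathrm{S}}(f)=\sum_{\tau\in\mathcal{F}(\mathcal{M})}\frac{|f(\tau)|^2}{|\tau|}$, $\ \mathscr{V}(f)=\frac16\sum_{[v_i,v_j,v_k]\in\mathcal{F}(\mathcal{M})}f_i^\top(f_j\times f_k)$, and $E_{\mathbb{A}}(f)=\frac{|\mathcal{M}|}{3\mathscr{V}(f)}E_{\mathrm{S}}(f)-3\mathscr{V}(f)$. Spherical coordinates. Write $f_i=(\sin\theta_i\cos\phi_i,\ \sin\theta_i\sin\phi_i,\ \cos\theta_i)$. Two vertices are kept fixed throughout; the coordinates $(\theta_i,\phi_i)$ of the remaining $n-2$ vertices are the optimization variables, collected in $\mathbf{f}=(\boldsymbol{\theta}^\top,\boldsymbol{\phi}^\top)^\top\in\mathbb{R}^{2(n-2)}$. $E_{\mathbb{A}}(\mathbf{f})$ is $E_{\mathbb{A}}$ regarded as a function of $\mathbf{f}$, and $\nabla_{\mathbf{f}}E_{\mathbb{A}}$ is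 its gradient with respect to these variables. Nondegenerate region. The set of $\mathbf{f}$ at which all image-face areas $|f(\tau)|$ and the volume $\mathscr{V}(f)$ are nonzero. Preconditioner. $M=I_2\otimes L_S(\mathbf{f}^{(0)})$, where $L_S(\mathbf{f}^{(0)})$ denotes the $(n-2)\times(n-2)$ principal submatrix, obtained by deleting the rows and columns of the two fixed vertices, of the $n\times n$ weighted Laplacian $L_S(f)$ evaluated at the initial map: for $[v_i,v_j]\in\mathcal{E}(\mathcal{M})$ with adjacent faces $[v_i,v_j,v_k]$ and $[v_j,v_i,v_\ell]$, $$[L_S(f)]_{i,j}=-\tfrac12\Big(\tfrac{\cot\theta_{i,j}^k(f)}{\sigma_f([v_i,v_j,v_k])}+\tfrac{\cot\theta_{j,i}^\ell(f)}{\sigma_f([v_j,v_i,v_\ell])}\Big),$$ $[L_S(f)]_{i,i}=-\sum_{\ell\ne i}[L_S(f)]_{i,\ell}$, and all other entries are $0$. Here $\theta_{i,j}^k(f)$ is the angle at $f_k$ opposite to the edge $[f_i,f_j]$ in the triangle $[f_i,f_j,f_k]$, and $\sigma_f(\tau)=|\tau|/|f(\tau)|$. $M$ is kept fixed during the iteration. Iteration. Starting from an initial map with coordinates $\mathbf{f}^{(0)}$, set $\mathbf{p}^{(0)}=-M^{-1}\mathbf{g}^{(0)}$, and for $k\ge 0$ set $\mathbf{f}^{(k+1)}=\mathbf{f}^{(k)}+\alpha_k\mathbf{p}^{(k)}$ with step length $\alpha_k>0$; for $k\ge1$, $$\mathbf{p}^{(k)}=-M^{-1}\mathbf{g}^{(k)}+\beta_k\mathbf{p}^{(k-1)},\qquad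 \beta_k=\frac{{\mathbf{g}^{(k)}}^\top M^{-1}\mathbf{g}^{(k)}}{{\mathbf{g}^{(k-1)}}^\top M^{-1}\mathbf{g}^{(k-1)}}.$$ The sequence is understood to be infinite with all $\beta_k$ well defined (i.e. $\mathbf{g}^{(k)}\neq 0$ for all $k$). The norm is $\|\mathbf{g}\|_{M^{-1}}=\sqrt{\mathbf{g}^\top M^{-1}\mathbf{g}}$. *)

(* Defs.v *)
From HB Require Import structures.
From mathcomp Require Import all_boot all_order all_algebra.
From mathcomp Require Import all_classical all_reals all_analysis.
From mathcomp.real_closed Require Import mxtens.

Set Implicit Arguments.
Unset Strict Implicit.
Unset Printing Implicit Defensive.

Import Order.TTheory GRing.Theory Num.Theory.
Import numFieldNormedType.Exports.

Local Open Scope classical_set_scope.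
Local Open Scope ring_scope.

Section Euclid.
Variable R : realType.

Definition dotmx N (u v : 'cV[R]_N) : R := (u^T *m v) 0 0.

(* Euclidean norm; the library norm `|u| on matrices is the sup norm. *)
Definition enorm N (u : 'cV[R]_N) : R := Num.sqrt (dotmx u u).

(* Indices are added modulo 3. *)
Definition crossmx (u v : 'cV[R]_3) : 'cV[R]_3 :=
  \col_(i < 3) (u (i + 1) 0 * v (i + 2%:R) 0 - u (i + 2%:R) 0 * v (i + 1) 0).

Definition triangle_area (a b c : 'cV[R]_3) : R :=
  2^-1 * enorm (crossmx (b - a) (c - a)).

(* Angle at c opposite to the side [a, b] of the triangle [a, b, c]. *)
Definition angle_at (c a b : 'cV[R]_3) : R :=
  acos (dotmx (a - c) (b - c) / (enorm (a - c) * enorm (b - c))).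

Definition cot (t : R) : R := cos t / sin t.

Definition grad N (E : 'cV[R]_N -> R) (y : 'cV[R]_N) : 'cV[R]_N :=
  \col_i 'D_(delta_mx i 0) E y.

Definition sym_posdef N (M : 'M[R]_N) : Prop :=
  M^T = M /\ forall u : 'cV[R]_N, u != 0 -> 0 < dotmx u (M *m u).

Definition wnorm N (W : 'M[R]_N) (u : 'cV[R]_N) : R :=
  Num.sqrt (dotmx u (W *m u)).

End Euclid.

Section Mesh.
Variables (R : realType) (n : nat).

(* Each oriented face [v_i, v_j, v_k] is stored once, as one (arbitrary) of the
   three triples (i, j, k), (j, k, i), (k, i, j). *)
Record mesh := Mesh {
  vpos : 'I_n -> 'cV[R]_3;
  faces : {set 'I_n * 'I_n * 'I_n} }.

Definition fverts (t : 'I_n * 'I_n * 'I_n) : {set 'I_n} :=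
  [set t.1.1; t.1.2; t.2].

Definition is_face (T : mesh) (i j k : 'I_n) : bool :=
  [|| (i, j, k) \in faces T, (j, k, i) \in faces T | (k, i, j) \in faces T].

Definition half_edge (T : mesh) (i j : 'I_n) : bool :=
  [exists k, is_face T i j k].

Definition edges (T : mesh) : {set {set 'I_n}} :=
  [set e : {set 'I_n} | (#|e| == 2%N) &&
     [exists t in faces T, e \subset fverts t]].

Definition euler_char (T : mesh) : int :=
  n%:Z - #|edges T|%:Z + #|faces T|%:Z.

Definition image_area (f : 'I_n -> 'cV[R]_3) (t : 'I_n * 'I_n * 'I_n) : R :=
  triangle_area (f t.1.1) (f t.1.2) (f t.2).

Definition hull (v : 'I_n -> 'cV[R]_3) (S : {set 'I_n}) : set 'cV[R]_3 :=
  [set x | exists w : 'I_n -> R,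
     [/\ forall i, 0 <= w i, forall i, i \notin S -> w i = 0,
         \sum_i w i = 1 & x = \sum_i w i *: v i]].

(* The flat triangles form a geometric simplicial complex in R^3. *)
Definition geometric_complex (T : mesh) : Prop :=
  [/\ forall t, t \in faces T -> #|fverts t| = 3%N,
      {in faces T &, injective fverts},
      forall i, exists2 t, t \in faces T & i \in fverts t,
      forall t, t \in faces T -> 0 < image_area (vpos T) t
    & forall t t', t \in faces T -> t' \in faces T ->
        hull (vpos T) (fverts t) `&` hull (vpos T) (fverts t')
          `<=` hull (vpos T) (fverts t :&: fverts t')].

(* Every edge lies in exactly two faces, which traverse it in opposite
   directions, and the link of every vertex is a single cycle. *)
Definition closed_oriented_surface (T : mesh) : Prop :=
  [/\ forall i j k k', is_face T i j k -> is_face T i j k' -> k = k',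
      forall i j, half_edge T i j -> half_edge T j i
    & forall i j k, half_edge T i j -> half_edge T i k ->
        connect (fun a b => is_face T i a b) j k].

Definition connected_mesh (T : mesh) : Prop :=
  forall i j, connect (half_edge T) i j.

(* Genus g of a connected closed oriented surface: euler_char = 2 - 2 g. *)
Definition closed_genus_zero_surface (T : mesh) : Prop :=
  [/\ geometric_complex T, closed_oriented_surface T, connected_mesh T
    & euler_char T = 2].

Definition mesh_area (T : mesh) : R :=
  \sum_(t in faces T) image_area (vpos T) t.

Definition stretch_energy (T : mesh) (f : 'I_n -> 'cV[R]_3) : R :=
  \sum_(t in faces T) image_area f t ^+ 2 / image_area (vpos T) t.

Definition volume (T : mesh) (f : 'I_n -> 'cV[R]_3) : R :=
  6^-1 * \sum_(t in faces T) dotmx (f t.1.1) (crossmx (f t.1.2) (f t.2)).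

Definition authalic_energy (T : mesh) (f : 'I_n -> 'cV[R]_3) : R :=
  mesh_area T / (3 * volume T f) * stretch_energy T f - 3 * volume T f.

Definition stretch_factor (T : mesh) (f : 'I_n -> 'cV[R]_3)
    (t : 'I_n * 'I_n * 'I_n) : R :=
  image_area (vpos T) t / image_area f t.

Definition half_weight (T : mesh) (f : 'I_n -> 'cV[R]_3) (i j : 'I_n) : R :=
  \sum_(k | is_face T i j k)
     cot (angle_at (f k) (f i) (f j)) / stretch_factor T f (i, j, k).

(* On a closed oriented surface each of the two sums has exactly one term if
   {i, j} is an edge, and none otherwise. *)
Definition edge_entry (T : mesh) (f : 'I_n -> 'cV[R]_3) (i j : 'I_n) : R :=
  - 2^-1 * (half_weight T f i j + half_weight T f j i).

Definition laplacian (T : mesh) (f : 'I_n -> 'cV[R]_3) : 'M[R]_n :=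
  \matrix_(i, j) if i == j then - \sum_(l | l != i) edge_entry T f i l
                 else edge_entry T f i j.

Definition sph (theta phi : R) : 'cV[R]_3 :=
  \col_(i < 3) [:: sin theta * cos phi; sin theta * sin phi; cos theta]`_i.

(* An injective s : 'I_(n - 2) -> 'I_n lists the free vertices; the (two, if
   2 <= n) vertices outside its image are fixed. *)
Definition theta_coord (y : 'cV[R]_(2 * (n - 2))) (j : 'I_(n - 2)) : R :=
  y (mxtens_index (0, j)) 0.

Definition phi_coord (y : 'cV[R]_(2 * (n - 2))) (j : 'I_(n - 2)) : R :=
  y (mxtens_index (1, j)) 0.

(* The values of q at free vertices are irrelevant. *)
Definition sphere_map (s : 'I_(n - 2) -> 'I_n) (q : 'I_n -> 'cV[R]_3)
    (y : 'cV[R]_(2 * (n - 2))) (i : 'I_n) : 'cV[R]_3 :=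
  if [pick j | s j == i] is Some j then sph (theta_coord y j) (phi_coord y j)
  else q i.

Definition coord_energy (T : mesh) (s : 'I_(n - 2) -> 'I_n)
    (q : 'I_n -> 'cV[R]_3) (y : 'cV[R]_(2 * (n - 2))) : R :=
  authalic_energy T (sphere_map s q y).

Definition nondegenerate_region (T : mesh) (s : 'I_(n - 2) -> 'I_n)
    (q : 'I_n -> 'cV[R]_3) : set 'cV[R]_(2 * (n - 2)) :=
  [set y | (forall t, t \in faces T -> image_area (sphere_map s q y) t != 0) /\
           volume T (sphere_map s q y) != 0].

Definition preconditioner (T : mesh) (s : 'I_(n - 2) -> 'I_n)
    (q : 'I_n -> 'cV[R]_3) (y0 : 'cV[R]_(2 * (n - 2))) :
    'M[R]_(2 * (n - 2)) :=
  tensmx (1%:M : 'M[R]_2) (mxsub s s (laplacian T (sphere_map s q y0))).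

End Mesh.

Section PNCG.
Variables (R : realType) (N : nat).

Definition FR_beta (W : 'M[R]_N) (gprev gcur : 'cV[R]_N) : R :=
  dotmx gcur (W *m gcur) / dotmx gprev (W *m gprev).

(* beta has a nonzero denominator at every step because all gradients are
   required to be nonzero. *)
Definition pncg_iteration (E : 'cV[R]_N -> R) (M : 'M[R]_N)
    (x p : nat -> 'cV[R]_N) (alpha : nat -> R) : Prop :=
  let g k := grad E (x k) in
  [/\ forall k, g k != 0,
      forall k, 0 < alpha k,
      forall k, x k.+1 = x k + alpha k *: p k,
      p 0%N = - (invmx M *m g 0%N)
    & forall k, p k.+1 = - (invmx M *m g k.+1)
                         + FR_beta (invmx M) (g k) (g k.+1) *: p k].

Definition strong_Wolfe (E : 'cV[R]_N -> R) (c1 c2 : R)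
    (x p : nat -> 'cV[R]_N) (alpha : nat -> R) : Prop :=
  let g k := grad E (x k) in
  forall k,
    E (x k.+1) - E (x k) <= c1 * alpha k * dotmx (g k) (p k) /\
    `|dotmx (g k.+1) (p k)| <= c2 * `|dotmx (g k) (p k)|.

End PNCG.

(* Main.v *)
Require Import Defs.
From mathcomp Require Import all_boot all_order all_algebra.
From mathcomp Require Import all_classical all_reals all_analysis.
From mathcomp.real_closed Require Import mxtens.
From mathcomp Require Import ring lra.
Import Order.TTheory GRing.Theory Num.Theory.
Import numFieldNormedType.Exports.
Local Open Scope classical_set_scope.
Local Open Scope ring_scope.

(** The theorem is the Al-Baali convergence proof for the Fletcher-Reeves
    method, carried out in the inner products of [M] and [invmx M], once the
    energy is known to be bounded and to have a Lipschitz gradient on [K].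

    Smoothness.  Areas enter the energy only through their squares, so, as
    functions of the spherical coordinates, the stretch energy S and the volume
    V are polynomials in sines and cosines of the coordinates: they are bounded
    and Lipschitz on the whole space, and so are their partial derivatives.  The
    energy is a (V^-1 S) - 3 V with a constant a.  On the compact set [K], where
    V does not vanish, |V| is bounded away from 0, hence the energy and its
    partial derivatives are bounded and Lipschitz on [K]
    ([coord_energy_bounded_lipschitz]).  The Lipschitz bound holds for any two
    points of [K], near or far, so the segments joining consecutive iterates
    may leave the nondegenerate region.

    Convergence.  Write g for the gradients, p for the directions,
    gam = g^T M^-1 g and P = p^T M p.
    - By induction, the strong curvature condition with c2 < 1/2 keeps the
      ratio - g^T p / gam between two positive constants
      ([directional_derivative_bounds]).
    - If gam stays above a positive constant, expanding P along the recurrence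
      for p makes P / gam^2 grow at most linearly in the index
      ([direction_growth]).
    - The curvature condition and the Lipschitz gradient force a step length of
      order at least - g^T p / P, so by sufficient decrease the energy drops by
      a multiple of (g^T p)^2 / P, as in Zoutendijk's condition.  With the two
      previous points the drop at step k is at least a constant times
      1 / (k + 1), and the divergence of the harmonic series contradicts the
      lower bound on the energy ([gradient_norms_arbitrarily_small]). *)

(* The unqualified name would denote the Hermitian form on row vectors. *)
Local Notation dotmx := Defs.dotmx.

(** * Bounded Lipschitz functions *)

Section BoundedLipschitz.
Context {R : realType} {V : normedModType R}.
Implicit Types (K : set V) (f g : V -> R).

(** A single constant for both bounds makes closure under products and
    inverses a matter of arithmetic. *)
Definition bounded_lipschitz K f : Prop :=
  exists2 C : R, forall x, K x -> `|f x| <= C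
    & forall x y, K x -> K y -> `|f x - f y| <= C * `|x - y|.

Lemma bounded_lipschitz_sub K K' f :
  K `<=` K' -> bounded_lipschitz K' f -> bounded_lipschitz K f.
Proof.
move=> KK' [C fC fL]; exists C => [x /KK'|x y /KK' Kx /KK' Ky]; first exact: fC.
exact: fL.
Qed.

Lemma bounded_lipschitz_cst K (c : R) : bounded_lipschitz K (fun=> c).
Proof.
exists `|c| => // x y _ _; rewrite subrr normr0.
by rewrite mulr_ge0.
Qed.

Lemma bounded_lipschitzD K f g : bounded_lipschitz K f ->
  bounded_lipschitz K g -> bounded_lipschitz K (fun x => f x + g x).
Proof.
move=> [C fC fL] [D gD gL]; exists (C + D) => [x Kx|x y Kx Ky].
  by rewrite (le_trans (ler_normD _ _))// lerD ?fC ?gD.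
rewrite opprD addrACA (le_trans (ler_normD _ _))// mulrDl.
by rewrite lerD ?fL ?gL.
Qed.

Lemma bounded_lipschitzM K f g : bounded_lipschitz K f ->
  bounded_lipschitz K g -> bounded_lipschitz K (fun x => f x * g x).
Proof.
move=> [C fC fL] [D gD gL]; exists (2 * `|C * D|) => [x Kx|x y Kx Ky].
  have C0 := le_trans (normr_ge0 _) (fC _ Kx).
  have D0 := le_trans (normr_ge0 _) (gD _ Kx).
  rewrite normrM (le_trans (ler_pM _ _ (fC _ Kx) (gD _ Kx)))//.
  by rewrite (le_trans (ler_norm _))// ler_peMl// ler1n.
have C0 := le_trans (normr_ge0 _) (fC _ Kx).
have D0 := le_trans (normr_ge0 _) (gD _ Kx).
(* Split the increment of the product as in the Leibniz rule. *)
rewrite (_ : f x * g x - f y * g y = f x * (g x - g y) + (f x - f y) * g y);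
  last by ring.
rewrite (le_trans (ler_normD _ _))// !normrM.
rewrite (_ : _ * _ * _ = C * (D * `|x - y|) + C * `|x - y| * D); last first.
  by rewrite !ger0_norm//; ring.
by rewrite lerD// ler_pM ?fC ?gD ?fL ?gL.
Qed.

Lemma bounded_lipschitzV K f (m : R) : 0 < m -> (forall x, K x -> m <= `|f x|) ->
  bounded_lipschitz K f -> bounded_lipschitz K (fun x => (f x)^-1).
Proof.
move=> m0 fm [C fC fL]; exists (m^-1 + `|C| * m^-1 * m^-1) => [x Kx|x y Kx Ky].
  rewrite normfV (le_trans (y := m^-1))//.
    by rewrite lef_pV2 ?fm// posrE// (lt_le_trans m0)// fm.
  by rewrite lerDl !mulr_ge0// invr_ge0 ltW.
have nz z : K z -> f z != 0.
  by move=> Kz; rewrite -normr_gt0 (lt_le_trans m0)// fm.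
have le_inv z : K z -> `|f z|^-1 <= m^-1.
  by move=> Kz; rewrite lef_pV2 ?fm// posrE// normr_gt0 nz.
rewrite (_ : _ - _ = (f y - f x) * ((f x)^-1 * (f y)^-1)); last first.
  by field; rewrite !nz.
rewrite !normrM !normfV distrC mulrDl.
rewrite (le_trans (y := C * `|x - y| * (m^-1 * m^-1)))//.
  by rewrite ler_pM ?mulr_ge0 ?invr_ge0// ?fL// ler_pM ?invr_ge0 ?le_inv.
have -> : C = `|C| by rewrite ger0_norm// (le_trans (normr_ge0 _) (fC _ Kx)).
rewrite normr_id mulrAC -!mulrA lerDr mulr_ge0// invr_ge0 ltW//.
Qed.

Lemma bounded_lipschitz_continuous f :
  bounded_lipschitz [set: V] f -> continuous f.
Proof.
move=> [C fC fL] x; apply/cvgrPdist_le => _/posnumP[e].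
have C0 := le_trans (normr_ge0 _) (fC x I).
near=> y.
rewrite (le_trans (fL x y I I))//.
rewrite (le_trans (y := (C + 1) * `|x - y|))//; first by rewrite ler_wpM2r// lerDl.
rewrite mulrC -ler_pdivlMr; last by rewrite ltr_pwDr.
near: y; apply: (cvgr_dist_le id x _) => //.
by rewrite divr_gt0// ltr_pwDr.
Unshelve. all: by end_near. Qed.

(** Applied to the volume, this keeps the denominator of the energy away
    from 0. *)
Lemma compact_bounded_away K f : bounded_lipschitz [set: V] f -> compact K ->
  (forall x, K x -> f x != 0) ->
  exists2 m : R, 0 < m & forall x, K x -> m <= `|f x|.
Proof.
move=> fB cK fK; have [[x0 Kx0]|K0] := pselect (K !=set0); last first.
  by exists 1 => // x Kx; case: K0; exists x.
have [|x /set_mem xK xmin] :=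
    @compact_EVT_min _ _ (fun x => `|f x|) K (ex_intro _ x0 Kx0) cK.
  apply: continuous_subspaceT => z; apply: cvg_norm.
  exact: bounded_lipschitz_continuous.
exists `|f x|; first by rewrite normr_gt0 fK.
by move=> z /mem_set; exact: xmin.
Qed.

End BoundedLipschitz.

(** * Bounded functions with bounded Lipschitz partial derivatives *)

Section BoundedC11.
Context {R : realType} {N : nat}.
Implicit Types (f g : 'cV[R]_N -> R).

(** Only the partial derivatives that make up the gradient are required; asking
    for global bounds turns the class into an algebra that contains the sines
    and cosines of the coordinates. *)
Definition bounded_C11 f : Prop :=
  bounded_lipschitz [set: 'cV[R]_N] f /\
  forall i, exists2 f' : 'cV[R]_N -> R, bounded_lipschitz [set: 'cV[R]_N] f'
    & forall y, is_derive y (delta_mx i 0) f (f' y).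

Lemma bounded_C11_cst (c : R) : bounded_C11 (fun=> c).
Proof.
split; first exact: bounded_lipschitz_cst.
move=> i; exists (fun=> 0); first exact: bounded_lipschitz_cst.
move=> y; exact: is_derive_cst.
Qed.

Lemma bounded_C11D f g : bounded_C11 f -> bounded_C11 g ->
  bounded_C11 (fun y => f y + g y).
Proof.
move=> [fB fD] [gB gD]; split; first exact: bounded_lipschitzD.
move=> i; have [f' f'B f'E] := fD i; have [g' g'B g'E] := gD i.
exists (fun y => f' y + g' y); first exact: bounded_lipschitzD.
by move=> y; exact: is_deriveD.
Qed.

Lemma bounded_C11M f g : bounded_C11 f -> bounded_C11 g ->
  bounded_C11 (fun y => f y * g y).
Proof.
move=> [fB fD] [gB gD]; split; first exact: bounded_lipschitzM.
move=> i; have [f' f'B f'E] := fD i; have [g' g'B g'E] := gD i.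
exists (fun y => f y * g' y + g y * f' y).
  by apply: bounded_lipschitzD; exact: bounded_lipschitzM.
by move=> y; exact: is_deriveM.
Qed.

Lemma bounded_C11_sum (I : Type) (r : seq I) (P : pred I)
    (F : I -> 'cV[R]_N -> R) : (forall i, bounded_C11 (F i)) ->
  bounded_C11 (fun y => \sum_(i <- r | P i) F i y).
Proof.
move=> FB; elim: r => [|i r IH].
  under eq_fun do rewrite big_nil; exact: bounded_C11_cst.
under eq_fun do rewrite big_cons.
case: (P i) => //; exact: bounded_C11D.
Qed.

(** Along a coordinate axis the function is [g] composed with an affine function
    of one real variable, to which the one-dimensional chain rule applies. *)
Lemma is_derive_coord (g : R -> R) (d : R) (y : 'cV[R]_N) (i j : 'I_N) :
  is_derive (y j 0) 1 g d ->
  is_derive y (delta_mx i 0) (fun z : 'cV[R]_N => g (z j 0)) (d * (j == i)%:R).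
Proof.
move=> gd.
pose l : R -> R := cst (y j 0) + (j == i)%:R *: id.
have ld : is_derive (0 : R) 1 l ((j == i)%:R).
  rewrite -[X in is_derive _ _ _ X]add0r -[X in _ + X]mulr1.
  exact: is_deriveD (is_derive_cst _ _ _) (is_deriveZ _ (is_derive_id _ _)).
have gl : is_derive (0 : R) 1 (g \o l) (d * (j == i)%:R).
  have l0 : l 0 = y j 0 by rewrite -[LHS]/(y j 0 + (j == i)%:R * 0) mulr0 addr0.
  by apply: is_derive1_comp; rewrite l0.
have E : (fun h : R => (fun z : 'cV[R]_N => g (z j 0)) (h *: delta_mx i 0 + y))
         = g \o l.
  apply/funext => h /=; congr g.
  by rewrite -[RHS]/(y j 0 + (j == i)%:R * h) !mxE eqxx andbT addrC mulrC.
split; first by apply/derivable1P; rewrite E; case: gl.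
case: gl => _ <-; rewrite -E /derive.
set q1 := fun h : R => h^-1 *: _; set q2 := fun h : R => h^-1 *: _.
suff -> : q1 = q2 by [].
by apply/funext => h; rewrite /q1 /q2 /= addr0 scale0r add0r [_%:A]mulr1.
Qed.

Lemma lipschitz_of_derive_le1 (g g' : R -> R) :
  (forall x : R, is_derive x 1 g (g' x)) -> (forall x, `|g' x| <= 1) ->
  forall a b, `|g a - g b| <= `|a - b|.
Proof.
move=> gd g1; suff H a b : a <= b -> `|g a - g b| <= `|a - b|.
  move=> a b; case: (leP a b) => [/H//|/ltW/H]; by rewrite distrC (distrC b).
move=> ab; have [|c _ E] := MVT_segment ab (fun z _ => gd z).
  apply: continuous_subspaceT => z; apply: differentiable_continuous.
  by apply/derivable1_diffP; case: (gd z).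
by rewrite distrC E normrM (distrC a) ler_piMl.
Qed.

Lemma ler_coord_norm (y : 'cV[R]_N) j : `|y j 0| <= `|y|.
Proof.
rewrite [leRHS](_ : _ = mx_norm y)// mx_normrE.
exact: (le_bigmax _ (fun ij : 'I_N * 'I_1 => `|y ij.1 ij.2|) (j, 0)).
Qed.

Lemma bounded_C11_trig (j : 'I_N) :
  bounded_C11 (fun y : 'cV[R]_N => sin (y j 0)) /\
  bounded_C11 (fun y : 'cV[R]_N => cos (y j 0)).
Proof.
have sB : bounded_lipschitz [set: 'cV[R]_N] (fun y => sin (y j 0)).
  exists 1 => [y _|y z _ _]; first by rewrite ler_norml sin_geN1 sin_le1.
  rewrite mul1r (le_trans _ (ler_coord_norm (y - z) j))// !mxE.
  apply: (lipschitz_of_derive_le1 _ (@cos R)) => x.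
  by rewrite ler_norml cos_geN1 cos_le1.
have cB : bounded_lipschitz [set: 'cV[R]_N] (fun y => cos (y j 0)).
  exists 1 => [y _|y z _ _]; first by rewrite ler_norml cos_geN1 cos_le1.
  rewrite mul1r (le_trans _ (ler_coord_norm (y - z) j))// !mxE.
  apply: (lipschitz_of_derive_le1 _ (fun x : R => - sin x)) => x.
  by rewrite normrN ler_norml sin_geN1 sin_le1.
split; split => // i.
  exists (fun y => cos (y j 0) * (j == i)%:R).
    by apply: bounded_lipschitzM => //; exact: bounded_lipschitz_cst.
  by move=> y; apply: is_derive_coord.
exists (fun y => - sin (y j 0) * (j == i)%:R).
  apply: bounded_lipschitzM; last exact: bounded_lipschitz_cst.
  under eq_fun do rewrite -mulN1r.
  by apply: bounded_lipschitzM => //; exact: bounded_lipschitz_cst.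
by move=> y; apply: is_derive_coord.
Qed.

End BoundedC11.

(** * Euclidean inner product *)

Section Dot.
Context {R : realType} {N : nat}.
Implicit Types (u v w : 'cV[R]_N) (A : 'M[R]_N).

Lemma dotmxE u v : dotmx u v = \sum_i u i 0 * v i 0.
Proof. by rewrite /Defs.dotmx mxE; apply: eq_bigr => i _; rewrite mxE. Qed.

Lemma dotmx_ge0 u : 0 <= dotmx u u.
Proof. by rewrite dotmxE sumr_ge0// => i _; rewrite -expr2 sqr_ge0. Qed.

Lemma dotmxC u v : dotmx u v = dotmx v u.
Proof. by rewrite !dotmxE; apply: eq_bigr => i _; rewrite mulrC. Qed.

Lemma dotmxDr u v w : dotmx u (v + w) = dotmx u v + dotmx u w.
Proof. by rewrite /Defs.dotmx mulmxDr mxE. Qed.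

Lemma dotmxZr u (a : R) v : dotmx u (a *: v) = a * dotmx u v.
Proof. by rewrite /Defs.dotmx -scalemxAr mxE. Qed.

Lemma dotmxNr u v : dotmx u (- v) = - dotmx u v.
Proof. by rewrite /Defs.dotmx mulmxN mxE. Qed.

Lemma dotmxDl u v w : dotmx (v + w) u = dotmx v u + dotmx w u.
Proof. by rewrite dotmxC dotmxDr !(dotmxC u). Qed.

Lemma dotmxZl u (a : R) v : dotmx (a *: v) u = a * dotmx v u.
Proof. by rewrite dotmxC dotmxZr dotmxC. Qed.

Lemma dotmxNl u v : dotmx (- v) u = - dotmx v u.
Proof. by rewrite dotmxC dotmxNr dotmxC. Qed.

Lemma dotmx_mulmx A u v : dotmx u (A *m v) = dotmx (A^T *m u) v.
Proof. by rewrite /Defs.dotmx trmx_mul trmxK mulmxA. Qed.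

Lemma dotmx_delta i u : dotmx (delta_mx i 0) u = u i 0.
Proof.
rewrite dotmxE (bigD1 i)//= big1 ?addr0 ?mxE ?eqxx ?mul1r// => j /negbTE ji.
by rewrite mxE ji mul0r.
Qed.

End Dot.

(** * Smoothness of the authalic energy *)

Section Energy.
Context {R : realType} {n : nat}.
Variables (T : mesh R n) (s : 'I_(n - 2) -> 'I_n) (q : 'I_n -> 'cV[R]_3).
Local Notation coords := 'cV[R]_(2 * (n - 2)).

Definition bounded_C11_vector (F : coords -> 'cV[R]_3) : Prop :=
  forall r, bounded_C11 (fun y => F y r 0).

Lemma bounded_C11_vectorB F G : bounded_C11_vector F -> bounded_C11_vector G ->
  bounded_C11_vector (fun y => F y - G y).
Proof.
move=> FB GB r; under eq_fun do rewrite !mxE -mulN1r.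
apply: bounded_C11D => //; apply: bounded_C11M => //; exact: bounded_C11_cst.
Qed.

Lemma bounded_C11_crossmx F G : bounded_C11_vector F -> bounded_C11_vector G ->
  bounded_C11_vector (fun y => crossmx (F y) (G y)).
Proof.
move=> FB GB r; under eq_fun do rewrite !mxE -mulN1r.
apply: bounded_C11D; first exact: bounded_C11M.
apply: bounded_C11M; [exact: bounded_C11_cst|exact: bounded_C11M].
Qed.

Lemma bounded_C11_dotmx F G : bounded_C11_vector F -> bounded_C11_vector G ->
  bounded_C11 (fun y => dotmx (F y) (G y)).
Proof.
move=> FB GB; under eq_fun do rewrite dotmxE.
apply: bounded_C11_sum => i; exact: bounded_C11M.
Qed.

(** Each coordinate of a vertex image is either constant or a product of sines
    and cosines of at most two entries of [y]. *)
Lemma bounded_C11_sphere_map i :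
  bounded_C11_vector (fun y => sphere_map s q y i).
Proof.
move=> r; rewrite /sphere_map; case: pickP => [j _|_]; last first.
  exact: bounded_C11_cst.
have [thS thC] := @bounded_C11_trig R _ (mxtens_index (0, j) : 'I_(2 * (n - 2))).
have [phS phC] := @bounded_C11_trig R _ (mxtens_index (1, j) : 'I_(2 * (n - 2))).
under eq_fun do rewrite /sph mxE /theta_coord /phi_coord.
by case: r => -[|[|[|//]]] /= _; do ?apply: bounded_C11M.
Qed.

Lemma bounded_C11_volume : bounded_C11 (fun y => volume T (sphere_map s q y)).
Proof.
apply: bounded_C11M; first exact: bounded_C11_cst.
apply: bounded_C11_sum => t; apply: bounded_C11_dotmx.
  exact: bounded_C11_sphere_map.
by apply: bounded_C11_crossmx; exact: bounded_C11_sphere_map.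
Qed.

(** Squaring removes the square root in the area and leaves a polynomial in the
    coordinates of the vertices. *)
Lemma sqr_triangle_area (a b c : 'cV[R]_3) : triangle_area a b c ^+ 2 =
  4^-1 * dotmx (crossmx (b - a) (c - a)) (crossmx (b - a) (c - a)).
Proof.
by rewrite /triangle_area exprMn /enorm sqr_sqrtr ?dotmx_ge0// exprVn expr2 -natrM.
Qed.

Lemma bounded_C11_stretch_energy :
  bounded_C11 (fun y => stretch_energy T (sphere_map s q y)).
Proof.
apply: bounded_C11_sum => t; apply: bounded_C11M; last exact: bounded_C11_cst.
rewrite /image_area; under eq_fun do rewrite sqr_triangle_area.
apply: bounded_C11M; first exact: bounded_C11_cst.
have sB := bounded_C11_sphere_map.
by apply: bounded_C11_dotmx; apply: bounded_C11_crossmx;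
  apply: bounded_C11_vectorB.
Qed.

(** The partial derivatives are given by the quotient rule only at points of [K],
    which suffices: the Lipschitz bound compares values at points of [K]. *)
Lemma coord_energy_bounded_lipschitz (K : set coords) : compact K ->
  K `<=` nondegenerate_region T s q ->
  bounded_lipschitz K (coord_energy T s q) /\
  forall i, bounded_lipschitz K (fun y => grad (coord_energy T s q) y i 0).
Proof.
move=> cK Knd; pose V y := volume T (sphere_map s q y).
have [m m0 Vm] : exists2 m : R, 0 < m & forall y, K y -> m <= `|V y|.
  by apply: compact_bounded_away bounded_C11_volume.1 cK _ => y /Knd[].
pose S y := stretch_energy T (sphere_map s q y).
have [VB VD] := bounded_C11_volume; have [SB SD] := bounded_C11_stretch_energy.
have toK f := @bounded_lipschitz_sub R _ K _ f (@subsetT _ K).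
have VVB : bounded_lipschitz K (fun y => (V y)^-1).
  by apply: (bounded_lipschitzV _ _ m m0 Vm); exact: toK.
have cB (c : R) := bounded_lipschitz_cst K c.
have EE : coord_energy T s q =
    fun y => mesh_area T / 3 * ((V y)^-1 * S y) + - 3 * V y.
  by apply/funext => y; rewrite /coord_energy /authalic_energy -/(V y) -/(S y) invfM; ring.
split.
  rewrite EE; apply: bounded_lipschitzD.
    by do 2?[apply: bounded_lipschitzM => //]; exact: toK.
  by apply: bounded_lipschitzM => //; exact: toK.
move=> i; have [V' V'B V'E] := VD i; have [S' S'B S'E] := SD i.
pose G y := mesh_area T / 3 *
  ((V y)^-1 * S' y + S y * (- ((V y)^-1 * (V y)^-1) * V' y)) + - 3 * V' y.
suff GE y : K y -> grad (coord_energy T s q) y i 0 = G y.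
  have [C GC GL] : bounded_lipschitz K G.
    apply: bounded_lipschitzD; last by apply: bounded_lipschitzM => //; exact: toK.
    apply: bounded_lipschitzM => //; apply: bounded_lipschitzD.
      by apply: bounded_lipschitzM => //; exact: toK.
    apply: bounded_lipschitzM; first exact: toK.
    apply: bounded_lipschitzM; last exact: toK.
    under eq_fun do rewrite -mulN1r.
    by apply: bounded_lipschitzM => //; exact: bounded_lipschitzM.
  by exists C => [y Ky|y z Ky Kz]; rewrite !GE//; [exact: GC|exact: GL].
move=> Ky; rewrite mxE.
have Vy0 : V y != 0 by case: (Knd y Ky).
have VVE : is_derive y (delta_mx i 0) (fun y => (V y)^-1) (- (V y) ^- 2 *: V' y).
  split; first by apply: derivableV => //; case: (V'E y).
  by rewrite deriveV//; case: (V'E y) => // _ ->.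
have EG : is_derive y (delta_mx i 0) (coord_energy T s q) (G y).
  rewrite EE.
  have dP := is_deriveM (is_derive_cst (mesh_area T / 3 : R) y (delta_mx i 0))
    (is_deriveM VVE (S'E y)).
  have dV := is_deriveM (is_derive_cst (- 3 : R) y (delta_mx i 0)) (V'E y).
  apply: is_derive_eq (is_deriveD dP dV) _.
  by rewrite !scaler0 !addr0 /G -invfM -expr2.
by case: EG.
Qed.

End Energy.

(** * Limits of real sequences *)

Section Scalar.
Context {R : realType}.

(** A nonnegative sequence with arbitrarily late, arbitrarily small terms has all
    its tail infima equal to 0. *)
Lemma limn_einf_eq0 (u : nat -> R) : (forall k, 0 <= u k) ->
  (forall (e : R) n0, 0 < e -> exists2 k, (n0 <= k)%N & u k < e) ->
  limn_einf (fun k => (u k)%:E) = 0%E.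
Proof.
move=> u0 usmall; rewrite limn_einf_lim.
suff -> : einfs (fun k => (u k)%:E) = fun=> 0%E by rewrite lim_cst.
apply/funext => m; rewrite /einfs /=; apply/eqP; rewrite eq_le; apply/andP; split.
  apply/lee_addgt0Pr => e e0; rewrite add0e.
  have [k mk uk] := usmall e m e0.
  rewrite (le_trans (y := (u k)%:E))//; last by rewrite lee_fin ltW.
  by apply: ereal_inf_lbound; exists k.
by apply: le_ereal_inf_tmp => /= _ [k mk <-]; rewrite lee_fin.
Qed.

(** Absorbing the finitely many initial terms lets the estimates below start at
    index 0. *)
Lemma pos_sequence_bounded_away (u : nat -> R) (e : R) n0 : 0 < e ->
  (forall k, 0 < u k) -> (forall k, (n0 <= k)%N -> e <= u k) ->
  exists2 e', 0 < e' & forall k, e' <= u k.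
Proof.
move=> + u0; elim: n0 e => [|n0 IH] e e0 ue; first by exists e => // k; exact: ue.
apply: (IH (Num.min e (u n0))) => [|k]; first by rewrite lt_min e0 u0.
rewrite leq_eqVlt => /orP[/eqP<-|/ue ek]; first by rewrite ge_min lexx orbT.
by rewrite ge_min ek.
Qed.

(** Telescoping the drops compares [F] with the divergent harmonic series. *)
Lemma harmonic_decrease_unbounded (F : nat -> R) (kappa B : R) : 0 < kappa ->
  (forall k, kappa * k.+1%:R^-1 <= F k - F k.+1) -> exists k, F k < B.
Proof.
move=> kappa_gt0 dec; apply: contrapT => nB.
have FB k : B <= F k by rewrite leNgt; apply/negP => FkB; apply: nB; exists k.
apply: (@dvg_harmonic R); apply: nondecreasing_is_cvgn.
  by apply: nondecreasing_series => k _ _; exact: harmonic_ge0.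
exists ((F 0%N - B) / kappa) => _ [m _ <-].
rewrite ler_pdivlMr//.
suff H : series harmonic m * kappa <= F 0%N - F m by rewrite (le_trans H)// lerB.
elim: m => [|m IH]; first by rewrite /series /= big_geq// mul0r subrr.
rewrite seriesSr mulrDl [harmonic m * _]mulrC.
by rewrite (le_trans (lerD IH (dec m)))// subrKA.
Qed.

(** * The Fletcher-Reeves recurrences for scalar quantities *)

(** Only inner products of gradients and directions matter for the convergence
    argument.  With g, p, x the gradients, directions and iterates, [gam k] is
    g_k^T M^-1 g_k, [d k] is g_k^T p_k, [e k] is g_{k+1}^T p_k, [P k] is
    p_k^T M p_k and [F k] is the energy at x_k. *)
Section FletcherReeves.
Variables (c1 c2 L B : R) (gam d e P alpha F : nat -> R).
Hypotheses (c1_gt0 : 0 < c1) (c2_gt0 : 0 < c2) (c2_lt : c2 < 2^-1) (L_gt0 : 0 < L).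
Hypothesis gam_gt0 : forall k, 0 < gam k.
Hypothesis P_ge0 : forall k, 0 <= P k.
Hypothesis alpha_gt0 : forall k, 0 < alpha k.
Hypothesis d0 : d 0%N = - gam 0%N.
Hypothesis dS : forall k, d k.+1 = - gam k.+1 + gam k.+1 / gam k * e k.
Hypothesis P0 : P 0%N = gam 0%N.
Hypothesis PS : forall k, P k.+1 =
  gam k.+1 - 2 * (gam k.+1 / gam k) * e k + (gam k.+1 / gam k) ^+ 2 * P k.
Hypothesis curvature : forall k, `|e k| <= c2 * `|d k|.
Hypothesis lipschitz : forall k, e k - d k <= L * alpha k * P k.
Hypothesis decrease : forall k, F k.+1 - F k <= c1 * alpha k * d k.
Hypothesis F_ge : forall k, B <= F k.

Let q := (1 - c2)^-1.
Let rho := 1 - c2 * q.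

Let c2_lt1 : 0 < 1 - c2.
Proof. by have := c2_lt; lra. Qed.

Let qE : q = 1 + c2 * q.
Proof. by rewrite /q; field; rewrite gt_eqF. Qed.

Let rho_gt0 : 0 < rho.
Proof. by rewrite subr_gt0 /q ltr_pdivrMr //; have := c2_lt; lra. Qed.

(** The recurrence for [d] gives - d_{k+1} / gam_{k+1} = 1 - e_k / gam_k.  If
    - d_k / gam_k <= q, the curvature condition bounds the last quotient by
    c2 q in absolute value, and q = 1 + c2 q makes the interval
    [1 - c2 q, 1 + c2 q] reproduce itself; its lower end is positive because
    c2 < 1/2. *)
Lemma directional_derivative_bounds k :
  rho * gam k <= - d k <= q * gam k.
Proof.
have q0 : 0 < q by rewrite invr_gt0.
elim: k => [|k /andP[lo hi]].
  have C0 : 0 <= c2 * q by rewrite mulr_ge0 ?ltW.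
  rewrite d0 opprK; apply/andP; split.
    by rewrite ler_piMl ?(ltW (gam_gt0 _))// /rho gerBl.
  by rewrite ler_peMl ?(ltW (gam_gt0 _))// qE lerDl.
have dneg : d k < 0 by rewrite -oppr_gt0 (lt_le_trans _ lo)// mulr_gt0.
have ek : `|e k| <= c2 * q * gam k.
  rewrite (le_trans (curvature k))// ltr0_norm// -mulrA ler_wpM2l// ltW//.
have be : `|gam k.+1 / gam k * e k| <= c2 * q * gam k.+1.
  rewrite normrM (gtr0_norm (divr_gt0 _ _))// mulrAC ler_pdivrMr//.
  rewrite [leRHS]mulrAC [leLHS]mulrC ler_pM2r//.
have qg : q * gam k.+1 = gam k.+1 + c2 * q * gam k.+1.
  by rewrite {1}qE mulrDl mul1r.
rewrite dS opprD opprK /rho mulrBl mul1r qg.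
move: be; rewrite ler_norml => /andP[b1 b2].
by apply/andP; split; lra.
Qed.

Lemma directional_derivative_lt0 k : d k < 0.
Proof.
have /andP[lo _] := directional_derivative_bounds k.
by rewrite -oppr_gt0 (lt_le_trans _ lo)// mulr_gt0.
Qed.

(** Dividing the recurrence for [P] by gam_{k+1}^2 shows that P / gam^2 grows at
    each step by at most (1 + 2 c2 q) / gam_{k+1}: the cross term is controlled
    by the curvature condition. *)
Lemma direction_growth (eps : R) : 0 < eps -> (forall k, eps <= gam k) ->
  forall k, P k <= (1 + 2 * c2 * q) / eps * k.+1%:R * gam k ^+ 2.
Proof.
move=> eps0 epsg.
have q0 : 0 < q by rewrite invr_gt0.
have C0 : 0 <= c2 * q by rewrite mulr_ge0 ?ltW.
set C := 1 + _.
have gam_le k : gam k <= eps^-1 * gam k ^+ 2.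
  by rewrite ler_pdivlMl// expr2 ler_pM2r.
elim=> [|k IH].
  rewrite P0 mulr1 (le_trans (gam_le 0%N))// ler_wpM2r ?sqr_ge0//.
  by rewrite ler_peMl ?invr_ge0 ?(ltW eps0)// /C; lra.
rewrite PS.
have bP : (gam k.+1 / gam k) ^+ 2 * P k <= C / eps * k.+1%:R * gam k.+1 ^+ 2.
  apply: le_trans (ler_wpM2l (sqr_ge0 _) IH) _.
  rewrite le_eqVlt; apply/orP; left; apply/eqP; field.
  by rewrite !gt_eqF.
have be : `|gam k.+1 / gam k * e k| <= c2 * q * gam k.+1.
  have /andP[_ hi] := directional_derivative_bounds k.
  rewrite normrM (gtr0_norm (divr_gt0 _ _))// mulrAC ler_pdivrMr//.
  rewrite [leRHS]mulrAC [leLHS]mulrC ler_pM2r//.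
  by rewrite (le_trans (curvature k))// ltr0_norm ?directional_derivative_lt0// -mulrA ler_wpM2l// ltW.
have Cg : C * gam k.+1 <= C * (eps^-1 * gam k.+1 ^+ 2).
  by rewrite ler_wpM2l// /C; lra.
rewrite -(natr1 k.+1) mulrDr mulrDl mulr1 -[C / eps * gam _ ^+ 2]mulrA.
move: be; rewrite ler_norml => /andP[b1 b2].
move: Cg; rewrite {1}/C => Cg; lra.
Qed.

(** If [gam] stayed above a positive constant, the energy would drop at step k
    by at least a constant times 1 / (k + 1). *)
Lemma gradient_norms_arbitrarily_small (eps : R) n0 : 0 < eps ->
  exists2 k, (n0 <= k)%N & gam k < eps.
Proof.
move=> eps0; apply: contrapT => nex.
have [|e' e'0 gam_ge] := pos_sequence_bounded_away gam eps n0 eps0 gam_gt0.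
  by move=> k nk; rewrite leNgt; apply/negP => gk; apply: nex; exists k.
have Pk := direction_growth e' e'0 gam_ge; set D := (_ / e') in Pk.
have q0 : 0 < q by rewrite invr_gt0.
have D0 : 0 < D.
  rewrite divr_gt0// ltr_pwDl//; by rewrite !mulr_ge0 ?ltW.
(* The constant left after cancelling gam_k^2 in the drop of the energy. *)
have kappa_gt0 : 0 < c1 * (1 - c2) * rho ^+ 2 / (L * D).
  by rewrite (divr_gt0 _ (mulr_gt0 L_gt0 D0))// !mulr_gt0// exprn_gt0.
have [k|k] := harmonic_decrease_unbounded F _ B kappa_gt0; last by rewrite ltNge F_ge.
have /andP[lo _] := directional_derivative_bounds k.
have dk := directional_derivative_lt0 k.
have Fdec : c1 * alpha k * - d k <= F k - F k.+1.
  by have := decrease k; rewrite mulrN; lra.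
have step : (1 - c2) * - d k <= L * alpha k * P k.
  have := lipschitz k; have := curvature k.
  rewrite (ltr0_norm dk) ler_norml => /andP[c _]; lra.
(* L P times the drop of the energy is at least c1 (- d) times L alpha P, which
   [step] bounds from below; the growth of P then bounds L P from above. *)
have dd : c1 * (1 - c2) * (rho * gam k) ^+ 2 <=
    L * (D * k.+1%:R * gam k ^+ 2) * (F k - F k.+1).
  apply: (@le_trans _ _ (c1 * (1 - c2) * (- d k) ^+ 2)).
    rewrite ler_pM2l ?mulr_gt0// ler_sqr// nnegrE; first by rewrite mulr_ge0 ?ltW.
    by rewrite oppr_ge0 ltW.
  apply: (@le_trans _ _ (L * P k * (c1 * alpha k * - d k))).
    have := ler_wpM2l (_ : 0 <= c1 * - d k) step => /(_ _) H.
    have /H : 0 <= c1 * - d k by rewrite mulr_ge0 ?ltW// oppr_gt0.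
    by rewrite le_eqVlt => /orP[/eqP|/ltW] {H}H; nra.
  apply: ler_pM => //.
  - by rewrite mulr_ge0// ltW.
  - by rewrite !mulr_ge0 ?ltW// oppr_gt0.
  - by rewrite ler_pM2l.
rewrite -(ler_pM2l (_ : 0 < L * D * k.+1%:R * gam k ^+ 2)); last first.
  have g2 := exprn_gt0 2 (gam_gt0 k).
  by apply: mulr_gt0 g2; apply: mulr_gt0 (ltr0Sn _ _); exact: mulr_gt0.
apply: (@le_trans _ _ (c1 * (1 - c2) * (rho * gam k) ^+ 2)); last first.
  by rewrite (le_trans dd)// -!mulrA.
rewrite le_eqVlt; apply/orP; left; apply/eqP; field.
by rewrite !gt_eqF.
Qed.

End FletcherReeves.
End Scalar.

(** * Positive definite matrices *)

Section PosDef.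
Context {R : realType} {N : nat}.
Variable M : 'M[R]_N.
Hypothesis Mspd : sym_posdef M.
Implicit Types (u v : 'cV[R]_N).
Local Notation W := (invmx M).

Lemma sym_posdef_ge0 u : 0 <= dotmx u (M *m u).
Proof.
have [->|u0] := eqVneq u 0; last by rewrite ltW// Mspd.2.
by rewrite mulmx0 /Defs.dotmx mulmx0 mxE.
Qed.

(** A row vector in the kernel of [M] would make the quadratic form vanish. *)
Lemma sym_posdef_unit : M \in unitmx.
Proof.
rewrite -row_free_unit -kermx_eq0; apply/eqP/row_matrixP => i; rewrite row0.
apply/eqP; apply: contraT => ri0.
set r := row i _ in ri0.
have rM : r *m M = 0 by rewrite /r -row_mul mulmx_ker row0.
have rT0 : r^T != 0 by rewrite -(inj_eq trmx_inj) trmxK trmx0.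
have := Mspd.2 _ rT0.
by rewrite /Defs.dotmx trmxK mulmxA rM mul0mx mxE ltxx.
Qed.

Lemma mulmx_invmx_cancel u : M *m (W *m u) = u.
Proof. by rewrite mulmxA mulmxV ?sym_posdef_unit// mul1mx. Qed.

Lemma dotmx_invmxl u v : dotmx (W *m u) (M *m v) = dotmx u v.
Proof. by rewrite dotmx_mulmx Mspd.1 mulmx_invmx_cancel. Qed.

Lemma invmx_posdef u : u != 0 -> 0 < dotmx u (W *m u).
Proof.
move=> u0; rewrite -dotmx_invmxl mulmx_invmx_cancel dotmxC.
have /(Mspd.2 _) : W *m u != 0.
  by apply: contraNneq u0 => Wu0; rewrite -(mulmx_invmx_cancel u) Wu0 mulmx0.
by rewrite mulmx_invmx_cancel dotmxC.
Qed.

(** With b = <u, u>, c = <v, v> and a = <u, v> for the form of [M], positivity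
    at the vector c u - a v reads c (b c - a^2) >= 0. *)
Lemma sym_posdef_Cauchy_Schwarz u v :
  dotmx u (M *m v) ^+ 2 <= dotmx u (M *m u) * dotmx v (M *m v).
Proof.
have [->|v0] := eqVneq v 0.
  by rewrite mulmx0 /Defs.dotmx !mulmx0 mxE expr0n mulr0.
have c0 := Mspd.2 _ v0.
set a := dotmx u _; set b := dotmx u _; set c := dotmx v _.
have := sym_posdef_ge0 (c *: u - a *: v).
have -> : dotmx v (M *m u) = a -> dotmx (c *: u - a *: v) (M *m (c *: u - a *: v))
   = c * (b * c - a ^+ 2).
  move=> vu; rewrite mulmxBr -!scalemxAr !(dotmxDl, dotmxNl, dotmxZl).
  rewrite !(dotmxDr, dotmxNr, dotmxZr) vu -/a -/b -/c; ring.
  by rewrite pmulr_rge0// subr_ge0.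
by rewrite dotmx_mulmx Mspd.1 dotmxC.
Qed.

(** The i-th coordinate of [u] is the [M]-inner product of [u] with the i-th
    column of the inverse, so this is Cauchy-Schwarz. *)
Lemma sqr_coord_le u i : u i 0 ^+ 2 <= W i i * dotmx u (M *m u).
Proof.
have := sym_posdef_Cauchy_Schwarz (W *m delta_mx i 0) u.
by rewrite !dotmx_invmxl !dotmx_delta -colE mxE.
Qed.

(** An explicit comparison of the sup norm with the norm of [M]; the trace of the
    inverse dominates each of its diagonal entries. *)
Lemma sqr_norm_le u : `|u| ^+ 2 <= (\sum_i W i i) * dotmx u (M *m u).
Proof.
have W0 i : 0 <= W i i.
  have d0 : delta_mx i 0 != 0 :> 'cV[R]_N.
    by apply/eqP => /matrixP/(_ i 0)/eqP; rewrite !mxE !eqxx oner_eq0.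
  by have := invmx_posdef _ d0; rewrite dotmx_delta -colE mxE => /ltW.
have uE : `|u| = mx_norm u by [].
have [u0|/mx_norm_neq0[[i j] /= uij]] := eqVneq (mx_norm u) 0.
  by rewrite uE u0 expr0n mulr_ge0 ?sym_posdef_ge0// sumr_ge0.
rewrite uE uij ord1 real_normK ?num_real// (le_trans (sqr_coord_le u i))//.
by rewrite ler_wpM2r ?sym_posdef_ge0// (bigD1 i)//= lerDl sumr_ge0.
Qed.

End PosDef.

(** * Convergence of the preconditioned conjugate gradient method *)

(** The method enters only through the inner products of gradients and
    directions.  The Lipschitz constant of the i-th partial derivative on [K]
    turns the change of the gradient along a step into a multiple of P, since
    the step is alpha p and the sup norm is controlled by the norm of [M]. *)
Theorem fletcher_reeves_liminf (R : realType) (N : nat)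
    (E : 'cV[R]_N -> R) (M : 'M[R]_N)
    (x p : nat -> 'cV[R]_N) (alpha : nat -> R) (c1 c2 : R) (K : set 'cV[R]_N) :
  sym_posdef M -> pncg_iteration E M x p alpha ->
  0 < c1 -> 0 < c2 -> c2 < 2^-1 -> strong_Wolfe E c1 c2 x p alpha ->
  (forall k, K (x k)) ->
  bounded_lipschitz K E ->
  (forall i, bounded_lipschitz K (fun y => grad E y i 0)) ->
  limn_einf (fun k => (wnorm (invmx M) (grad E (x k)))%:E) = 0%E.
Proof.
move=> Mspd [gn0 al0 xS p0 pS] c10 c20 c2h wolfe xK [B EB _] gL.
set W := invmx M in p0 pS *.
pose g k := grad E (x k).
have L_ex i : exists L : R, 0 <= L /\ forall y z, K y -> K z ->
    `|grad E y i 0 - grad E z i 0| <= L * `|y - z|.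
  have [L bL lL] := gL i; exists L; split=> //.
  exact: le_trans (normr_ge0 _) (bL _ (xK 0%N)).
have [L {}L_ex] := boolp.choice L_ex.
pose w := \sum_i W i i.
(* The 1 keeps the constant positive when all the [L i] vanish. *)
pose LL := \sum_i L i * w + 1.
pose P k := dotmx (p k) (M *m p k).
have P_ge0 k : 0 <= P k by exact: sym_posdef_ge0.
have MWg k : M *m (W *m g k) = g k by exact: mulmx_invmx_cancel.
have WgM k u : dotmx (W *m g k) (M *m u) = dotmx (g k) u by exact: dotmx_invmxl.
pose gam k := dotmx (g k) (W *m g k).
have gam_gt0 k : 0 < gam k by exact: (invmx_posdef _ Mspd _ (gn0 k)).
have w_ge0 : 0 <= w.
  have := sqr_norm_le _ Mspd (W *m g 0%N).
  rewrite WgM -/(gam 0%N) -/W -/w; move/(le_trans (sqr_ge0 _)).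
  by rewrite pmulr_lge0// invmx_posdef.
have LL_gt0 : 0 < LL.
  by rewrite ltr_wpDl// sumr_ge0// => i _; rewrite mulr_ge0// (L_ex i).1.
have lip k : dotmx (g k.+1) (p k) - dotmx (g k) (p k) <= LL * alpha k * P k.
  rewrite -dotmxNl -dotmxDl dotmxE.
  apply: (@le_trans _ _ (\sum_i L i * w * (alpha k * P k))); last first.
    rewrite -mulr_suml -mulrA ler_wpM2r//; last by rewrite lerDl.
    by rewrite mulr_ge0// ltW.
  apply: ler_sum => i _; rewrite (le_trans (ler_norm _))// normrM mxE [(- g k) i 0]mxE.
  have [Li0 Li] := L_ex i.
  have gi : `|g k.+1 i 0 - g k i 0| <= L i * (alpha k * `|p k|).
    apply: le_trans (Li _ _ (xK k.+1) (xK k)) _.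
    by rewrite xS addrAC subrr add0r normrZ (gtr0_norm (al0 k)).
  apply: le_trans (ler_pM _ _ gi (ler_coord_norm (p k) i)) _ => //.
  have -> : L i * (alpha k * `|p k|) * `|p k| = L i * alpha k * `|p k| ^+ 2.
    by ring.
  have -> : L i * w * (alpha k * P k) = L i * alpha k * (w * P k) by ring.
  by rewrite ler_wpM2l ?sqr_norm_le// mulr_ge0// ltW.
(* The lower bound on the energy is - B, as B bounds its absolute value. *)
have small eps n0 : 0 < eps -> exists2 k, (n0 <= k)%N & gam k < eps.
  apply: (@gradient_norms_arbitrarily_small R c1 c2 LL (- B) gam
    (fun k => dotmx (g k) (p k)) (fun k => dotmx (g k.+1) (p k)) P alpha
    (fun k => E (x k))) => //.
  - by rewrite p0 dotmxNr.
  - by move=> k; rewrite pS dotmxDr dotmxNr dotmxZr.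
  - by rewrite /P p0 mulmxN dotmxNr dotmxNl opprK WgM.
  - move=> k; rewrite /P pS mulmxDr mulmxN -scalemxAr.
    rewrite !(dotmxDl, dotmxNl, dotmxZl) !(dotmxDr, dotmxNr, dotmxZr).
    rewrite !WgM (dotmxC (p k) (M *m (W *m _))) MWg.
    by rewrite /FR_beta -/(gam k) -/(gam k.+1); ring.
  - by move=> k; have [_] := wolfe k.
  - by move=> k; have [] := wolfe k.
  - by move=> k; have := EB _ (xK k); rewrite ler_norml => /andP[].
apply: limn_einf_eq0 => [k|e n0 e0]; first exact: sqrtr_ge0.
have [k nk gk] := small (e ^+ 2) n0 (exprn_gt0 2 e0).
exists k => //; rewrite -(ger0_norm (ltW e0)) -sqrtr_sqr ltr_sqrt// exprn_gt0//.
Qed.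

Theorem theorem2 (R : realType) (n : nat) (T : mesh R n)
    (s : 'I_(n - 2) -> 'I_n) (q : 'I_n -> 'cV[R]_3)
    (x p : nat -> 'cV[R]_(2 * (n - 2))) (alpha : nat -> R) (c1 c2 : R)
    (K : set 'cV[R]_(2 * (n - 2))) :
  closed_genus_zero_surface T ->
  injective s ->
  (forall i, i \notin codom s -> enorm (q i) = 1) ->
  let E := coord_energy T s q in
  let M := preconditioner T s q (x 0%N) in
  pncg_iteration E M x p alpha ->
  0 < c1 -> c1 < c2 -> c2 < 2^-1 ->
  strong_Wolfe E c1 c2 x p alpha ->
  compact K ->
  K `<=` nondegenerate_region T s q ->
  (forall k, K (x k)) ->
  sym_posdef M ->
  limn_einf (fun k => (wnorm (invmx M) (grad E (x k)))%:E) = 0%E.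
Proof.
move=> _ _ _ E M iter c1_gt0 c12 c2_lt wolfe cK Knd xK Mspd.
have [EB gB] := coord_energy_bounded_lipschitz T s q K cK Knd.
exact: fletcher_reeves_liminf Mspd iter c1_gt0 (lt_trans c1_gt0 c12) c2_lt wolfe
  xK EB gB.
Qed.
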